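(* Let $X$ be a non-empty set, let $I_X$ be the set of finitely supported functions $X\to\mathbb{Z}_{\ge 0}$, let $\mathcal{N}:I_X\to\mathbb{Z}_{>0}$ be a norm function as in the context, and let $C_K(M)$ denote the associated generalized Ramanujan sums. (1) For every $K\in I_X$, $$\sum_{D\in I_X,\ D\le K} C_K(D)=\mathcal{N}(K)\prod_{p}\left(1-\frac{2}{\mathcal{N}(A_p)}\right),$$ where the product is over the points $p\in X$ with $K(p)\ne 0$, and $A_p\in I_X$ is the map with $A_p(p)=1$ and $A_p(q)=0$ for $q\neq p$. (2) For all $M,N\in I_X$, $$\sum_{D\in I_X,\ D\le N} C_D(M)=\begin{cases}\mathcal{N}(N) & \text{if } N\le M,\\ 0 & \text{otherwise.}\end{cases}$$ (3) Suppose that $X$ is at most countable and that $[x]=cx+O(x^{\alpha})$ for some $c>0$ and some $\alpha\in[0,1)$. Then for every $K\in I_X$ with $K\neq 0$, $$\sum_{M\in I_X}\frac{C_K(M)}{\mathcal{N}(M)}=-c\,\Lambda(K),$$ where $\Lambda(A)=\sum_{D\in I_X,\ D\le A}\mu(A-D)\log\mathcal{N}(D)$ for $A\in I_X$, and the infinite sum is understood as $\lim_{x\to\infty}\sum_{M\in I_X,\ \mathcal{N}(M)\le x}C_K(M)/\mathcal{N}(M)$ (the assertion being that this limit exists and equals $-c\Lambda(K)$).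
   Context: Let $X$ be a non-empty set and let $F_X$ be the set of all maps $A:X\to\mathbb{Z}$ such that $A(x)\ne 0$ for only finitely many $x\in X$; it is an abelian group under pointwise addition, with zero element $0$. For $A,B\in F_X$ write $A\le B$ if $A(x)\le B(x)$ for every $x\in X$. Let $I_X=\{A\in F_X: A\ge 0\}$. Fix a function $\mathcal{N}:I_X\to\mathbb{Z}_{>0}$ such that $\mathcal{N}(0)=1$, $\mathcal{N}(A)>1$ if $A\ne 0$, and $\mathcal{N}(A+B)=\mathcal{N}(A)\mathcal{N}(B)$ for all $A,B\in I_X$. The Möbius function $\mu$ on $I_X$ is defined by $\mu(A)=(-1)^{\sum_{x\in X}A(x)}$ if $A(X)\subset\{0,1\}$, and $\mu(A)=0$ otherwise. For $M,K\in I_X$, the generalized Ramanujan sum is $$C_K(M)=\sum_{D\in I_X,\ D\le M,\ D\le K}\mathcal{N}(D)\,\mu(K-D).$$ When $X$ is at most countable, for real $x>0$ put $[x]=\#\{A\in I_X:\mathcal{N}(A)\le x\}$ (this is not the integer part). The hypothesis $[x]=cx+O(x^\alpha)$ refers to $x\to\infty$ and includes that $[x]$ is finite for every $x>0$. *)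

(* Defs.v *)
From HB Require Import structures.
From mathcomp Require Import all_boot all_order all_algebra finmap multiset.
From mathcomp Require Import all_classical all_reals all_analysis.

Set Implicit Arguments.
Unset Strict Implicit.
Unset Printing Implicit Defensive.

Import Order.TTheory GRing.Theory Num.Theory.
Import numFieldNormedType.Exports.

Local Open Scope fset_scope.
Local Open Scope mset_scope.
Local Open Scope classical_set_scope.
Local Open Scope ring_scope.

(* Makes +oo available to the Landau notations. *)
Canonical pinfty_filter_on (R : numFieldType) :=
  FilterType (pinfty_nbhs R) (@filter_filter R _ (@proper_pinfty_nbhs R)).

(* The monoid I_X of finitely supported maps from X to the nonnegative integers
   is {mset X}, i.e. {fsfun X -> nat with 0}: addition is `+`,
   the pointwise order is `<=`, and the indicator A_p of a point is [mset p]. *)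

Section GeneralizedRamanujan.
Context {X : choiceType}.
Implicit Types A B D K M : {mset X}.

(* Values are positive: this follows from the first two clauses. *)
Definition norm_function (nm : {mset X} -> nat) : Prop :=
  [/\ nm mset0 = 1%N,
      (forall A, A != mset0 -> (1 < nm A)%N) &
      (forall A B, nm (A `+` B)%mset = (nm A * nm B)%N)].

Definition mobius A : int :=
  if `[< forall x, A x = 0%N \/ A x = 1%N >]
  then (-1) ^+ (\sum_(x <- finsupp A) A x)%N else 0.

(* In the sums below D `<=` K, so the truncated difference K `\` D is the
   pointwise difference of K and D as maps X -> Z. *)
Definition ramanujan_sum (nm : {mset X} -> nat) K M : int :=
  \sum_(D \in [set D | (D `<=` M)%mset && (D `<=` K)%mset])
    ((nm D)%:Z * mobius (K `\` D)%mset).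

Definition mangoldt (R : realType) (nm : {mset X} -> nat) A : R :=
  \sum_(D \in [set D | (D `<=` A)%mset])
    ((mobius (A `\` D)%mset)%:~R * ln ((nm D)%:R : R)).

Definition norm_le (R : realType) (nm : {mset X} -> nat) (x : R)
  : set {mset X} := [set A | (nm A)%:R <= x].

(* The counting function [x]; fset_set S is empty when S is infinite. *)
Definition norm_count (R : realType) (nm : {mset X} -> nat) (x : R) : R :=
  (#|` fset_set (norm_le nm x)|)%:R.

End GeneralizedRamanujan.

(* Main.v *)
Require Import Defs.
From HB Require Import structures.
From mathcomp Require Import all_boot all_order all_algebra finmap multiset.
From mathcomp Require Import all_classical all_reals all_analysis.
From mathcomp Require Import ring lra.

(** Everything rests on the identity that the sum of mu(D) over D <= A is 1 when
    A = 0 and 0 otherwise, and on its weighted form, the finite Euler product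
    [mobius_euler]: if h is multiplicative on disjoint supports, the sum of
    mu(D) h(D) over D <= A is the product of 1 - h(p) over the points p of A.
    Each of the three formulas follows after exchanging the sum that defines the
    Ramanujan sum with the outer sum, and substituting M = D + M' in the sums
    over the M above a given D ([fsum_superset_if]).

    For the sum of C_D(M) over D <= N, the inner sum is a Moebius sum over
    D' <= N - E, which leaves only the term E = N, present when N <= M.

    For the sum of C_K(D) over D <= K, the inner sum counts the D between E and
    K. With F = K - E and tau(F) the number of D <= F, the total is N(K) times
    the sum of mu(F) tau(F) / N(F) over F <= K, an Euler product with
    h(F) = tau(F) / N(F) and tau(p) = 2.

    For the series, let H(x) be the sum of 1 / N(M) over N(M) <= x. The partial
    sum up to x is the sum over D <= K of mu(K - D) H(x / N(D)). As K <> 0, the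
    weights mu(K - D) have sum 0, so H(x / N(D)) may be replaced by
    H(x / N(D)) - H(x). The limit then follows from
    H(y x) - H(x) --> c log y ([reciprocal_sum_cvg]), which holds as soon as the
    counting function is c x + o(x): cut ]x, y x] into k blocks of ratio
    r = y^(1/k); on each block, replacing 1 / N(M) by its value at either end
    gives c log r up to c (r - 1)^2 + o(1), and k such errors add up to
    O(1/k) + k o(1). *)

Import Order.TTheory GRing.Theory Num.Theory.
Import numFieldNormedType.Exports.
Local Open Scope mset_scope.
Local Open Scope classical_set_scope.
Local Open Scope ring_scope.

(** * Sums over the multisets below a given one *)

Local Notation submsets A := [set D | (D `<=` A)%mset].

Lemma submsets_add1 {X : choiceType} (p : X) (A : {mset X}) :
  submsets (p +` A)%mset =
  submsets A `|` [set (p +` D)%mset | D in submsets A].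
Proof.
apply/seteqP; split=> [D /= /msubsetP DpA|D /=].
  have [Dp0|Dp0] := eqVneq (D p) 0%N.
    left; apply/msubsetP => q; have := DpA q; rewrite mset1DE.
    by have [->|] := eqVneq q p; rewrite ?Dp0.
  right; exists (D `\ p)%mset; last by rewrite msetB1K -?mset_neq0.
  apply/msubsetP => q; rewrite msetB1E leq_subLR.
  by have := DpA q; rewrite mset1DE.
move=> [DA|[E EA <-]]; last exact: msetDS.
by apply: (msubset_trans DA); apply/msubsetP => q; rewrite mset1DE leq_addl.
Qed.

(** Adding one point at a time is what makes all the sums below computable by
    induction: one step either doubles the set of submultisets (new point) or
    only creates multisets that are not squarefree (old point). *)
Lemma mset_add1_ind {X : choiceType} (P : {mset X} -> Prop) :
  P mset0 -> (forall p A, P A -> P (p +` A)%mset) -> forall A, P A.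
Proof.
move=> P0 PS A; rewrite -[A]seq_mset_id; elim: (enum_mset A) => [|p s IHs].
  suff -> : seq_mset [::] = mset0 :> {mset X} by [].
  by apply/msetP => q; rewrite mset_seqE mset0E.
have -> : seq_mset (p :: s) = (p +` seq_mset s)%mset.
  by apply/msetP => q; rewrite mset1DE !mset_seqE /= eq_sym.
exact: PS.
Qed.

Lemma submsets0 {X : choiceType} : submsets (@mset0 X) = [set mset0].
Proof.
apply/seteqP; split=> [D /= /msubsetP D0|D /= ->]; last exact/msubsetP.
by apply/msetP => q; have := D0 q; rewrite mset0E leqn0 => /eqP.
Qed.

Lemma finite_submsets {X : choiceType} (A : {mset X}) : finite_set (submsets A).
Proof.
elim/(@mset_add1_ind X): A => [|p A finA].
  by rewrite submsets0; exact: finite_set1.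
by rewrite submsets_add1 finite_setU; split=> //; exact: finite_image.
Qed.

Lemma fsum_submsets_add1 {X : choiceType} (S : nmodType) (f : {mset X} -> S)
    (p : X) (A : {mset X}) : A p = 0%N ->
  \sum_(D \in submsets (p +` A)%mset) f D =
  \sum_(D \in submsets A) f D + \sum_(D \in submsets A) f (p +` D)%mset.
Proof.
move=> Ap0; rewrite submsets_add1 fsbigU0 //=.
- congr (_ + _); rewrite fsbig_image // => D E _ _.
  move=> /(congr1 (fun B => B `\ p)%mset).
  by rewrite !msetD1K.
- exact: finite_submsets.
- exact/finite_image/finite_submsets.
move=> _ [/[swap] [[E _ <-]]] /= /msubsetP /(_ p).
by rewrite mset1DE eqxx Ap0.
Qed.

Lemma fsum_submsets_compl {X : choiceType} (S : nmodType) (f : {mset X} -> S)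
    (A : {mset X}) :
  \sum_(D \in submsets A) f D = \sum_(D \in submsets A) f (A `\` D)%mset.
Proof.
apply: (@reindex_fsbig _ _ _ _ _ (fun D => A `\` D)%mset); split.
- by move=> D _ /=; exact: msubsetDl.
- by move=> D E; rewrite !inE /= => /msetBBK {2}<- /msetBBK {2}<- ->.
- move=> D DA; exists (A `\` D)%mset => /=; last exact: msetBBK.
  exact: msubsetDl.
Qed.

(** The substitution D = E + D'. It holds for infinite P too, being a bijection
    of index sets. *)
Lemma fsum_superset {X : choiceType} (S : nmodType) (f : {mset X} -> S)
    (P : set {mset X}) (E : {mset X}) :
  \sum_(D \in P `&` [set D | (E `<=` D)%mset]) f D =
  \sum_(D \in [set D | P (E `+` D)%mset]) f (E `+` D)%mset.
Proof.
apply: reindex_fsbig; split.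
- move=> D PD; split=> //=; apply/msubsetP => q; rewrite msetE2 leq_addr //.
- by move=> D D' _ _ /(congr1 (fun B => B `\` E)%mset); rewrite !msetDKB.
move=> D [PD /= /msetBDKC DE].
by exists (D `\` E)%mset => //=; rewrite DE.
Qed.

Lemma submsets_compl {X : choiceType} (E A : {mset X}) :
  (E `<=` A)%mset ->
  [set D | (E `+` D `<=` A)%mset] = submsets (A `\` E)%mset.
Proof.
move=> /msubsetP EA; apply/seteqP; split=> D /= /msubsetP DA;
  apply/msubsetP => q.
  by have := DA q; rewrite !msetE2 leq_subRL.
by have := DA q; rewrite !msetE2 leq_subRL.
Qed.

Lemma fsum_submsetsI {X : choiceType} (S : nmodType) (f : {mset X} -> S)
    (A B : {mset X}) :
  \sum_(D \in [set D | (D `<=` A)%mset && (D `<=` B)%mset]) f D =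
  \sum_(D \in submsets A) (if (D `<=` B)%mset then f D else 0).
Proof.
have -> : [set D | (D `<=` A)%mset && (D `<=` B)%mset] =
    submsets A `&` submsets B.
  by apply/seteqP; split=> [D /= /andP[? ?]//|D [/= ? ?]]; apply/andP.
by rewrite fsbig_mkcondr; apply: eq_fsbigr => D _; rewrite mem_setE.
Qed.

Lemma fsum_superset_if {X : choiceType} (S : nmodType) (f : {mset X} -> S)
    (P : set {mset X}) (E : {mset X}) :
  \sum_(D \in P) (if (E `<=` D)%mset then f D else 0) =
  \sum_(D \in [set D | P (E `+` D)%mset]) f (E `+` D)%mset.
Proof.
rewrite -fsum_superset fsbig_mkcondr; apply: eq_fsbigr => D _.
by rewrite mem_setE.
Qed.

Lemma intr_fsum {T : choiceType} (S : pzRingType) (P : set T) (f : T -> int) :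
  finite_set P ->
  (\sum_(t \in P) f t)%:~R = \sum_(t \in P) ((f t)%:~R : S).
Proof. by move=> finP; rewrite !fsbig_finite // rmorph_sum. Qed.

(** * The Moebius function and finite Euler products *)

Lemma finsupp_add1 {X : choiceType} (p : X) (A : {mset X}) :
  finsupp (p +` A)%mset = (p |` finsupp A)%fset.
Proof.
apply/fsetP => q; rewrite in_fset1U !mem_finsupp mset1DE.
by have [->|] := eqVneq q p.
Qed.

Lemma mobius0 {X : choiceType} : mobius (@mset0 X) = 1.
Proof.
rewrite /mobius asboolT => [|x]; last by left; rewrite mset0E.
by rewrite finsupp0 big_seq_fset0 expr0.
Qed.

Lemma mobius_add1 {X : choiceType} (p : X) (A : {mset X}) : A p = 0%N ->
  mobius (p +` A)%mset = - mobius A.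
Proof.
move=> Ap0; rewrite /mobius.
have -> : `[< forall x, (p +` A)%mset x = 0%N \/ (p +` A)%mset x = 1%N >] =
          `[< forall x, A x = 0%N \/ A x = 1%N >].
  apply: asbool_equiv_eq; split=> h x; have := h x; rewrite mset1DE.
    by have [->|//] := eqVneq x p; rewrite Ap0; left.
  by have [->|//] := eqVneq x p; rewrite Ap0; right.
case: asboolP => _; last by rewrite oppr0.
rewrite -[RHS]mulN1r -exprS; congr (_ ^+ _).
rewrite finsupp_add1.
rewrite big_fsetU1 /=; last by rewrite mem_finsupp Ap0.
rewrite mset1DE eqxx Ap0 add1n; congr (1 + _)%N.
rewrite !big_seq; apply: eq_bigr => q; rewrite mem_finsupp mset1DE.
by have [->|//] := eqVneq q p; rewrite Ap0.
Qed.

Lemma mobius_not_squarefree {X : choiceType} (p : X) (A : {mset X}) :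
  (1 < A p)%N -> mobius A = 0.
Proof.
move=> Ap; rewrite /mobius asboolF // => /(_ p).
by case=> eAp; rewrite eAp in Ap.
Qed.

(** Induction on A, one point p at a time. If p is new, the submultisets of
    p + A are the D and the p + D with D <= A, and mu(p + D) h(p + D) is
    - h(p) mu(D) h(D), whence the factor 1 - h(p). If p already occurs in A, the
    additional submultisets contain p at least twice, so mu vanishes on them,
    and the support of A does not change either. *)
Lemma mobius_euler {X : choiceType} (S : idomainType) (h : {mset X} -> S)
    (A : {mset X}) :
  h mset0 = 1 ->
  (forall (p : X) (D : {mset X}), D p = 0%N ->
     h (p +` D)%mset = h [mset p]%mset * h D) ->
  \sum_(D \in submsets A) (mobius D)%:~R * h D =
  \prod_(p <- finsupp A) (1 - h [mset p]%mset).
Proof.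
move=> h0 hM; elim/(@mset_add1_ind X): A => [|p A IHA].
  by rewrite submsets0 fsbig_set1 mobius0 h0 mulr1 finsupp0 big_seq_fset0.
have [Ap0|Ap0] := eqVneq (A p) 0%N.
  rewrite fsum_submsets_add1 // finsupp_add1 big_fsetU1 /=; last first.
    by rewrite mem_finsupp Ap0.
  rewrite mulrBl mul1r -IHA; congr (_ + _).
  rewrite -mulNr mulr_fsumr; apply: eq_fsbigr => D; rewrite inE /= => DA.
  have Dp0 : D p = 0%N.
    by have /msubsetP /(_ p) := DA; rewrite Ap0 leqn0 => /eqP.
  by rewrite mobius_add1 // hM // rmorphN /=; ring.
have -> : finsupp (p +` A)%mset = finsupp A.
  by rewrite finsupp_add1 mem_fset1U // mem_finsupp.
rewrite -IHA; apply/esym/fsbig_widen.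
  by rewrite submsets_add1; exact: subsetUl.
rewrite submsets_add1 => D [[//|[E EA <-]] nDA] /=.
rewrite (@mobius_not_squarefree _ p) ?mul0r // mset1DE eqxx.
rewrite -[X in (X < _)%N]addn0 ltn_add2l lt0n; apply/eqP => Ep0.
apply: nDA => /=; apply/msubsetP => q; rewrite mset1DE.
have [->|_] := eqVneq q p; first by rewrite Ep0 addn0 lt0n.
exact/msubsetP.
Qed.

Lemma sum_mobius {X : choiceType} (A : {mset X}) :
  \sum_(D \in submsets A) mobius D = (A == mset0)%:R :> int.
Proof.
have := @mobius_euler X int (fun=> 1) A erefl.
under eq_fsbigr do rewrite mulr1 intz.
move=> -> //; rewrite subrr.
have [->|] := eqVneq A mset0; first by rewrite finsupp0 big_seq_fset0.
move=> /eqP A0; have [p Ap] : exists p, A p != 0%N.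
  apply: contrapT => nA; apply: A0; apply/msetP => q; rewrite mset0E.
  by apply/eqP; apply/negPn/negP => Aq; apply: nA; exists q.
by rewrite (big_fsetD1 p) /= ?mem_finsupp // mul0r.
Qed.

(** * The two finite sums of Ramanujan sums *)

Lemma norm_gt0 {X : choiceType} (nm : {mset X} -> nat) (A : {mset X}) :
  norm_function nm -> (0 < nm A)%N.
Proof.
move=> [nm0 nmgt1 _]; have [->|/nmgt1] := eqVneq A mset0; first by rewrite nm0.
exact: ltnW.
Qed.

Lemma ramanujan_sumE {X : choiceType} (nm : {mset X} -> nat) (K M : {mset X}) :
  ramanujan_sum nm K M =
  \sum_(D \in submsets K)
    if (D `<=` M)%mset then (nm D)%:Z * mobius (K `\` D)%mset else 0.
Proof.
rewrite -fsum_submsetsI; apply: eq_fsbigl.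
by apply/seteqP; split=> D /=; rewrite andbC.
Qed.

(** After exchanging the sums, the coefficient of nm E is the sum of mu over
    the submultisets of N - E, or an empty sum if E is not below N. *)
Lemma ramanujan_divisor_sum {X : choiceType} (nm : {mset X} -> nat)
    (M N : {mset X}) :
  \sum_(D \in submsets N) ramanujan_sum nm D M =
  if (N `<=` M)%mset then (nm N)%:Z else 0.
Proof.
under eq_fsbigr do rewrite /ramanujan_sum fsum_submsetsI.
rewrite exchange_fsbig; try exact: finite_submsets.
transitivity (\sum_(E \in submsets M) (if E == N then (nm E)%:Z else 0)).
  apply: eq_fsbigr => E _; rewrite fsum_superset_if.
  under eq_fsbigr do rewrite msetDKB.
  rewrite -mulr_fsumr.
  have [EN|nEN] := boolP (E `<=` N)%mset.
    rewrite /= submsets_compl // sum_mobius msetB_eq0.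
    case: eqVneq => [->|neEN]; first by rewrite msubset_refl mulr1.
    have -> : (N `<=` E)%mset = false; last by rewrite mulr0.
    apply/negP => NE; move/eqP: neEN; apply.
    by apply/eqP; rewrite eqEmsubset EN.
  rewrite fsbig1 ?mulr0 => [|F /= EF].
    by case: eqVneq nEN => // ->; rewrite msubset_refl.
  case/negP: nEN; apply: msubset_trans EF.
  by apply/msubsetP => q; rewrite msetE2 leq_addr.
have [NM|nNM] := boolP (N `<=` M)%mset.
  rewrite (fsbigD1 N) ?eqxx //=; last exact: finite_submsets.
  by rewrite fsbig1 ?addr0 // => E [_ /= /eqP/negbTE ->].
by rewrite fsbig1 // => E /= EM; case: eqP => // EN; rewrite -EN EM in nNM.
Qed.

Definition card_submsets {X : choiceType} (A : {mset X}) : int :=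
  \sum_(D \in submsets A) (1 : int).

Lemma card_submsets0 {X : choiceType} : card_submsets (@mset0 X) = 1.
Proof. by rewrite /card_submsets submsets0 fsbig_set1. Qed.

Lemma card_submsets_add1 {X : choiceType} (p : X) (A : {mset X}) :
  A p = 0%N -> card_submsets (p +` A)%mset = 2 * card_submsets A.
Proof.
by move=> Ap0; rewrite /card_submsets fsum_submsets_add1 // mulrDl mul1r.
Qed.

(** Exchanging the sums gives weight tau(K - E) to the term of E, where tau
    counts submultisets; dividing by nm K turns this into an Euler product with
    h(F) = tau(F) / nm(F), multiplicative because a new point doubles tau. *)
Lemma ramanujan_argument_sum {R : realType} {X : choiceType}
    (nm : {mset X} -> nat) (K : {mset X}) : norm_function nm ->
  (\sum_(D \in submsets K) ramanujan_sum nm K D)%:~R =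
  (nm K)%:R * \prod_(p <- finsupp K) (1 - 2 / (nm [mset p]%mset)%:R) :> R.
Proof.
move=> hnm; have [nm0 _ nmD] := hnm.
have nmN0 A : (nm A)%:R != 0 :> R by rewrite pnatr_eq0 -lt0n norm_gt0.
under eq_fsbigr do rewrite ramanujan_sumE.
rewrite exchange_fsbig; try exact: finite_submsets.
have -> : \sum_(E \in submsets K) \sum_(D \in submsets K)
      (if (E `<=` D)%mset then (nm E)%:Z * mobius (K `\` E)%mset else 0) =
    \sum_(E \in submsets K)
      (nm E)%:Z * mobius (K `\` E)%mset * card_submsets (K `\` E)%mset.
  apply: eq_fsbigr => E; rewrite inE /= => EK.
  rewrite (fsum_superset_if _ (fun=> (nm E)%:Z * mobius (K `\` E)%mset)) /=.
  rewrite submsets_compl // /card_submsets mulr_fsumr.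
  by apply: eq_fsbigr => D _; rewrite mulr1.
rewrite intr_fsum; last exact: finite_submsets.
rewrite fsum_submsets_compl.
pose h (A : {mset X}) : R := (card_submsets A)%:~R / (nm A)%:R.
have hp p : h [mset p]%mset = 2 / (nm [mset p]%mset)%:R.
  have pE : [mset p]%mset = (p +` mset0)%mset by rewrite msetD0.
  by rewrite /h {1}pE card_submsets_add1 ?mset0E // card_submsets0 mulr1.
under eq_bigr do rewrite -hp.
rewrite -mobius_euler; last 2 first.
- by rewrite /h card_submsets0 nm0 divr1.
- move=> p D Dp0; rewrite hp /h card_submsets_add1 // nmD natrM rmorphM /=.
  by field; rewrite !nmN0.
rewrite mulr_fsumr; apply: eq_fsbigr => D; rewrite inE /= => DK.
rewrite msetBBK // /h !rmorphM /= -{2}(msetBDK DK) nmD natrM pmulrn.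
by field.
Qed.

(** * Sums of reciprocals of a sequence with linear counting function *)

Definition sublevel {R : realType} {T : choiceType} (a : T -> R) (x : R) :
  set T := [set t | a t <= x].

Section ReciprocalSums.
Context {R : realType} {T : choiceType} (a : T -> R) (c : R).
Hypothesis a_gt0 : forall t, 0 < a t.
Hypothesis finite_sublevel : forall x, 0 < x -> finite_set (sublevel a x).
Hypothesis c_ge0 : 0 <= c.

Let N x : R := \sum_(t \in sublevel a x) (1 : R).
Let H x : R := \sum_(t \in sublevel a x) (a t)^-1.

Lemma fsum_sublevel_diff (f : T -> R) (x y : R) : 0 < x -> x <= y ->
  \sum_(t \in sublevel a y) f t - \sum_(t \in sublevel a x) f t =
  \sum_(t \in sublevel a y `\` sublevel a x) f t.
Proof.
move=> x0 xy; rewrite (fsbigID (sublevel a x)) /=; last first.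
  exact/finite_sublevel/(lt_le_trans x0).
rewrite setIidr; last by move=> t /= /le_trans; apply.
by rewrite addrAC subrr add0r.
Qed.

Lemma ler_fsum (P : set T) (f g : T -> R) : finite_set P ->
  (forall t, P t -> f t <= g t) -> \sum_(t \in P) f t <= \sum_(t \in P) g t.
Proof.
move=> finP fg; rewrite !fsbig_finite // big_seq [leRHS]big_seq.
by apply: ler_sum => t; rewrite in_fset_set // inE => /fg.
Qed.

Lemma reciprocal_sum_bounds (x y : R) : 0 < x -> x <= y ->
  (N y - N x) / y <= H y - H x <= (N y - N x) / x.
Proof.
move=> x0 xy; have y0 := lt_le_trans x0 xy.
have finD : finite_set (sublevel a y `\` sublevel a x).
  exact/finite_setD/finite_sublevel.
rewrite !fsum_sublevel_diff // !mulr_fsuml; apply/andP; split;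
  apply: ler_fsum => // t [/= ay /negP]; rewrite -ltNge mul1r => xa.
  by rewrite lef_pV2 ?posrE.
by rewrite lef_pV2 ?posrE // ltW.
Qed.

(** One block ]x, r x]. Each term 1 / a t lies between 1 / (r x) and 1 / x, so
    the block sum is between c (1 - 1/r) and c (r - 1) up to the counting error.
    ln r lies between 1 - 1/r and r - 1 as well, and these two bounds
    differ by at most (r - 1)^2. *)
Lemma reciprocal_sum_step (delta x r : R) : 0 < x -> 1 <= r ->
  `|N x - c * x| <= delta * x ->
  `|N (r * x) - c * (r * x)| <= delta * (r * x) ->
  `|H (r * x) - H x - c * ln r| <= c * (r - 1) ^+ 2 + delta * (r + 1).
Proof.
move=> x0 r1 Nx Nrx; have r0 : 0 < r by exact: lt_le_trans r1.
have d0 : 0 <= delta by rewrite -(pmulr_lge0 _ x0); apply: le_trans Nx.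
have /andP[Hlo Hup] : (N (r * x) - N x) / (r * x) <= H (r * x) - H x
    <= (N (r * x) - N x) / x.
  by apply: reciprocal_sum_bounds => //; rewrite ler_peMl // ltW.
have lnup : ln r <= r - 1.
  by have := @le_ln1Dx _ (r - 1); rewrite [1 + _]addrC subrK; apply; lra.
have lnlo : 1 - r^-1 <= ln r.
  have := @le_ln1Dx _ (r^-1 - 1); rewrite [1 + _]addrC subrK lnV ?posrE //.
  have : 0 < r^-1 by rewrite invr_gt0.
  by move=> ? /(_ _); lra.
have sq : (r - 1) - (1 - r^-1) <= (r - 1) ^+ 2.
  have -> : (r - 1) - (1 - r^-1) = (r - 1) ^+ 2 * r^-1 by field; lra.
  by apply: ler_piMr; [exact: sqr_ge0|rewrite invf_le1].
have clnup := ler_wpM2l c_ge0 lnup; have clnlo := ler_wpM2l c_ge0 lnlo.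
have csq := ler_wpM2l c_ge0 sq.
move: Nx Nrx; rewrite !ler_norml => /andP[Nx1 Nx2] /andP[Nrx1 Nrx2].
have up : (N (r * x) - N x) / x <= c * (r - 1) + delta * (r + 1).
  by rewrite ler_pdivrMr //; lra.
have lo : c * (1 - r^-1) - delta * (r + 1) <= (N (r * x) - N x) / (r * x).
  rewrite ler_pdivlMr ?mulr_gt0 //.
  have -> : (c * (1 - r^-1) - delta * (r + 1)) * (r * x) =
      c * (r - 1) * x - delta * (r + 1) * x * r by field; lra.
  have : delta * (r + 1) * x <= delta * (r + 1) * x * r.
    by apply: ler_peMr => //; rewrite !mulr_ge0 // ?ltW //; lra.
  lra.
by apply/andP; split; lra.
Qed.

(** The k blocks of ratio r telescope, on both sides of the comparison. *)
Lemma reciprocal_sum_pow (delta x r : R) (k : nat) : 0 < x -> 1 <= r ->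
  (forall y, x <= y -> `|N y - c * y| <= delta * y) ->
  `|H (r ^+ k * x) - H x - c * ln (r ^+ k)| <=
    (c * (r - 1) ^+ 2 + delta * (r + 1)) *+ k.
Proof.
move=> x0 r1 Nx; have r0 : 0 < r by exact: lt_le_trans r1.
elim: k => [|k IHk]; first by rewrite expr0 mul1r subrr ln1 mulr0 subrr normr0.
have xk : x <= r ^+ k * x by rewrite ler_peMl ?exprn_ege1 // ltW.
have xk0 := lt_le_trans x0 xk.
have /= step := @reciprocal_sum_step delta (r ^+ k * x) r xk0 r1 (Nx _ xk)
  (Nx _ (le_trans xk (ler_peMl (ltW xk0) r1))).
have -> : H (r ^+ k.+1 * x) - H x - c * ln (r ^+ k.+1) =
    (H (r * (r ^+ k * x)) - H (r ^+ k * x) - c * ln r) +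
    (H (r ^+ k * x) - H x - c * ln (r ^+ k)).
  rewrite exprS -mulrA lnM ?posrE ?exprn_gt0 //; ring.
by rewrite mulrS; apply: (le_trans (ler_normD _ _)); apply: lerD.
Qed.

(** With r = y^(1/k), the k quadratic errors sum to at most
    c (y ln y)^2 / k. So k is chosen first, to make this at most e / 2, and then
    delta, to make the k counting errors sum to at most e / 2; the x beyond
    which the counting function is within delta x of c x depends on both. *)
Lemma reciprocal_sum_cvg (y : R) : 1 <= y ->
  (forall delta, 0 < delta ->
    \forall x \near +oo, `|N x - c * x| <= delta * x) ->
  H (y * x) - H x @[x --> +oo] --> c * ln y.
Proof.
move=> y1 Nasym; apply/cvgrPdist_le => e e0.
have y0 : 0 < y by exact: lt_le_trans y1.
set L := ln y; have L0 : 0 <= L by exact: ln_ge0.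
have [k kP] : exists k : nat, 2 * (c * (y * L) ^+ 2) / e < k.+1%:R.
  by exists (Num.truncn (2 * (c * (y * L) ^+ 2) / e)); rewrite truncnS_gt.
have k0 : 0 < k.+1%:R :> R by rewrite ltr0n.
pose delta := e / (2 * k.+1%:R * (y + 1)).
have d0 : 0 < delta by rewrite divr_gt0 // !mulr_gt0 //; lra.
pose r := expR (L / k.+1%:R).
have r1 : 1 <= r by rewrite -expR0 ler_expR divr_ge0.
have rk : r ^+ k.+1 = y.
  by rewrite /r -expRM_natl mulrCA divff ?mulr1 ?lnK ?posrE // lt0r_neq0.
have ry : r <= y by rewrite -rk exprS ler_peMr ?exprn_ege1 // ltW // expR_gt0.
(* From 1 - u <= exp (- u) = 1 / r with u = L / (k + 1), and r <= y. *)
have r1L : r - 1 <= y * L / k.+1%:R.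
  rewrite -mulrA; set u := L / k.+1%:R; have u0 : 0 <= u by rewrite divr_ge0.
  have h : r * (1 - u) <= r * r^-1.
    by rewrite ler_pM2l ?expR_gt0 // /r -expRN expR_ge1Dx.
  rewrite divff ?lt0r_neq0 ?expR_gt0 // mulrBr mulr1 in h.
  by have := ler_wpM2r u0 ry; lra.
have err : (c * (r - 1) ^+ 2 + delta * (r + 1)) *+ k.+1 <= e.
  rewrite -mulr_natr mulrDl.
  have e1 : c * (r - 1) ^+ 2 * k.+1%:R <= e / 2.
    have : c * (r - 1) ^+ 2 <= c * (y * L / k.+1%:R) ^+ 2.
      rewrite ler_wpM2l // ler_sqr ?nnegrE ?subr_ge0 //.
      by apply: le_trans r1L; rewrite subr_ge0.
    rewrite -(ler_pM2r k0) => /le_trans; apply.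
    have -> : c * (y * L / k.+1%:R) ^+ 2 * k.+1%:R =
        c * (y * L) ^+ 2 / k.+1%:R by field; rewrite lt0r_neq0.
    by rewrite ler_pdivrMr //; move: kP; rewrite ltr_pdivrMr //; lra.
  have e2 : delta * (r + 1) * k.+1%:R <= e / 2.
    have -> : e / 2 = delta * (y + 1) * k.+1%:R.
      by rewrite /delta; field; apply/andP; split; apply/lt0r_neq0; lra.
    by rewrite ler_pM2r // ler_pM2l //; lra.
  lra.
have [A [Areal NA]] := Nasym _ d0.
exists (Num.max A 1); split; first by rewrite num_real.
move=> x; rewrite gt_max => /andP[Ax x1] /=; have x0 : 0 < x by lra.
rewrite distrC /L -rk; apply: (le_trans _ err).
by apply: reciprocal_sum_pow => // z xz; apply: NA; exact: lt_le_trans xz.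
Qed.

End ReciprocalSums.

(** * The Ramanujan series *)

(** The term of D in C_K(M) involves the M above D, that is M = D + M', for
    which nm D / nm M = 1 / nm M' and the bound nm M <= x becomes
    nm M' <= x / nm D. *)
Lemma ramanujan_series_partial {R : realType} {X : choiceType}
    (nm : {mset X} -> nat) (K : {mset X}) (x : R) : norm_function nm ->
  finite_set (norm_le nm x) ->
  \sum_(M \in norm_le nm x) ((ramanujan_sum nm K M)%:~R / (nm M)%:R : R) =
  \sum_(D \in submsets K) ((mobius (K `\` D)%mset)%:~R *
    \sum_(M \in norm_le nm (x / (nm D)%:R)) ((nm M)%:R^-1 : R)).
Proof.
move=> hnm finx; have [_ _ nmD] := hnm.
have nmN0 A : (nm A)%:R != 0 :> R by rewrite pnatr_eq0 -lt0n norm_gt0.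
transitivity (\sum_(M \in norm_le nm x) \sum_(D \in submsets K)
    (if (D `<=` M)%mset then
      (nm D)%:R * (mobius (K `\` D)%mset)%:~R / (nm M)%:R : R else 0)).
  apply: eq_fsbigr => M _; rewrite ramanujan_sumE.
  rewrite intr_fsum; last exact: finite_submsets.
  rewrite mulr_fsuml; apply: eq_fsbigr => D _.
  by case: ifP; rewrite ?mul0r // rmorphM /= -pmulrn.
rewrite exchange_fsbig //; last exact: finite_submsets.
apply: eq_fsbigr => D _; rewrite fsum_superset_if mulr_fsumr.
have -> : [set M | norm_le nm x (D `+` M)%mset] = norm_le nm (x / (nm D)%:R).
  apply/seteqP; split=> M; rewrite /norm_le /= ler_pdivlMr ?ltr0n ?norm_gt0 //;
  by rewrite nmD natrM mulrC.
by apply: eq_fsbigr => M _; rewrite nmD natrM; field; rewrite !nmN0.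
Qed.

Lemma norm_countE {R : realType} {X : choiceType} (nm : {mset X} -> nat)
    (x : R) :
  finite_set (norm_le nm x) ->
  norm_count nm x = \sum_(M \in norm_le nm x) (1 : R).
Proof.
move=> finx; rewrite fsbig_finite // big_const_seq count_predT.
by rewrite iter_addr addr0.
Qed.

(** x^alpha = x^(alpha - 1) x, and the first factor tends to 0. *)
Lemma bigO_powR_asymptotic {R : realType} (f : R -> R) (c alpha : R) :
  alpha < 1 ->
  f = (fun x : R => c * x) +O_ (pinfty_nbhs R) (fun x : R => x `^ alpha) ->
  forall delta, 0 < delta -> \forall x \near +oo, `|f x - c * x| <= delta * x.
Proof.
move=> a1 /eqaddOP [k0 [_ k0P]] delta d0.
pose k := Num.max (k0 + 1) 1.
have k1 : 1 <= k by rewrite le_max lexx orbT.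
have /k0P fk : k0 < k by rewrite lt_max ltrDl ltr01.
near=> x.
have x0 : 0 < x by near: x; exact: nbhs_pinfty_gt.
have fx : `|f x - c * x| <= k * `|x `^ alpha| by near: x; exact: fk.
apply: (le_trans fx); rewrite ger0_norm ?powR_ge0 //.
have xE : x `^ (1 - alpha) * x `^ alpha = x.
  by rewrite -powRD ?subrK ?powRr1 ?ltW // implybE (gt_eqF x0) orbT.
rewrite -[leRHS](congr1 ( *%R delta) xE) mulrA.
apply: ler_wpM2r; rewrite ?powR_ge0 // mulrC -ler_pdivrMr //.
have kd0 : 0 <= k / delta by rewrite divr_ge0 ?ltW //; lra.
have -> : k / delta = ((k / delta) `^ (1 - alpha)^-1) `^ (1 - alpha).
  by rewrite -powRrM mulVf ?powRr1 // subr_eq0 gt_eqF.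
have xB : (k / delta) `^ (1 - alpha)^-1 <= x.
  by near: x; apply: nbhs_pinfty_ge; rewrite num_real.
apply: ge0_ler_powR; rewrite ?nnegrE ?powR_ge0 ?subr_ge0 ?(ltW a1) //.
Unshelve. all: by end_near. Qed.

(** As K <> 0, the coefficients mu(K - D) sum to 0, so H(x) can be
    subtracted from each H(x / nm D): each H(x / nm D) diverges, but the
    differences tend to - c log (nm D). *)
Lemma ramanujan_series {R : realType} {X : choiceType}
    (nm : {mset X} -> nat) (K : {mset X}) (c : R) : norm_function nm ->
  0 <= c -> (forall x : R, 0 < x -> finite_set (norm_le nm x)) ->
  (forall delta : R, 0 < delta ->
     \forall x \near +oo, `|norm_count nm x - c * x| <= delta * x) ->
  K != mset0 ->
  \sum_(M \in norm_le nm x) ((ramanujan_sum nm K M)%:~R / (nm M)%:R : R)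
    @[x --> +oo_R] --> - (c * mangoldt R nm K).
Proof.
move=> hnm c0 fin Nasym K0.
have nm0 A : 0 < (nm A)%:R :> R by rewrite ltr0n norm_gt0.
pose recip (x : R) := \sum_(M \in norm_le nm x) ((nm M)%:R^-1 : R).
have shift D : recip (x / (nm D)%:R) - recip x @[x --> +oo] -->
    - (c * ln (nm D)%:R).
  have nm1 : 1 <= (nm D)%:R :> R by rewrite ler1n norm_gt0.
  have lim := @reciprocal_sum_cvg R _ (fun A => (nm A)%:R) c nm0 fin c0 _ nm1.
  have {}lim : recip ((nm D)%:R * x) - recip x @[x --> +oo] -->
      c * ln (nm D)%:R.
    apply: lim => delta /Nasym h; near=> x.
    have x0 : 0 < x by near: x; exact: nbhs_pinfty_gt.
    rewrite -norm_countE; last exact: fin.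
    by near: x.
  have nmV0 : 0 < (nm D)%:R^-1 :> R by rewrite invr_gt0.
  have E x : recip (x / (nm D)%:R) - recip x =
      - (recip ((nm D)%:R * (x / (nm D)%:R)) - recip (x / (nm D)%:R)).
    by rewrite opprB [_ * (_ / _)]mulrC divfK // lt0r_neq0.
  under eq_cvg do rewrite E.
  exact: cvg_comp (gt0_cvgMly nmV0 cvg_id) (cvgN lim).
rewrite (_ : - (c * mangoldt R nm K) = \sum_(D <- fset_set (submsets K))
   (mobius (K `\` D)%mset)%:~R * - (c * ln (nm D)%:R)); last first.
  rewrite /mangoldt fsbig_finite; last exact: finite_submsets.
  rewrite mulr_sumr -sumrN; apply: eq_bigr => D _; ring.
apply: (@cvg_trans _ (\sum_(D <- fset_set (submsets K))
    ((mobius (K `\` D)%mset)%:~R * (recip (x / (nm D)%:R) - recip x))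
    @[x --> +oo])); last first.
  apply: cvg_big => [|D _]; first exact: add_continuous.
  by apply: cvgMr; exact: shift.
apply: near_eq_cvg; near=> x.
have x0 : 0 < x by near: x; exact: nbhs_pinfty_gt.
rewrite ramanujan_series_partial //; last exact: fin.
have sum0 : \sum_(D \in submsets K) ((mobius (K `\` D)%mset)%:~R : R) = 0.
  rewrite -(@fsum_submsets_compl X R (fun D => (mobius D)%:~R)) -intr_fsum.
    by rewrite sum_mobius (negbTE K0).
  exact: finite_submsets.
rewrite -[RHS]subr0 -[X in _ - X](mul0r (recip x)) -[X in X * _]sum0 mulr_fsuml.
rewrite !fsbig_finite; try exact: finite_submsets.
by rewrite -sumrB; apply: eq_bigr => D _; rewrite mulrBr.
Unshelve. all: by end_near. Qed.

Theorem theorem1 (R : realType) (X : choiceType) (hX : [set: X] !=set0)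
    (nm : {mset X} -> nat) (hnm : norm_function nm) :
  [/\ (forall K : {mset X},
         (\sum_(D \in [set D | (D `<=` K)%mset]) ramanujan_sum nm K D)%:~R =
         (nm K)%:R * \prod_(p <- finsupp K) (1 - 2 / (nm [mset p]%mset)%:R) :> R),
      (forall M N : {mset X},
         \sum_(D \in [set D | (D `<=` N)%mset]) ramanujan_sum nm D M =
         if (N `<=` M)%mset then (nm N)%:Z else 0) &
      (countable [set: X] ->
       forall c alpha : R, 0 < c -> 0 <= alpha -> alpha < 1 ->
       (forall x : R, 0 < x -> finite_set (norm_le nm x)) ->
       norm_count nm =
         (fun x : R => c * x) +O_ (pinfty_nbhs R) (fun x : R => x `^ alpha) ->
       forall K : {mset X}, K != mset0 ->
         \sum_(M \in norm_le nm x) ((ramanujan_sum nm K M)%:~R / (nm M)%:R : R)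
           @[x --> +oo_R] --> - (c * mangoldt R nm K))].
Proof.
split.
- by move=> K; exact: ramanujan_argument_sum.
- by move=> M N; exact: ramanujan_divisor_sum.
move=> _ c alpha c0 _ alpha1 fin countO K K0.
apply: ramanujan_series => //; first exact: ltW.
exact: bigO_powR_asymptotic countO.
Qed.
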